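(* Let $m\ge 0$ and $n\ge 1$ be integers and let $K,K',L,L'$ be simplicial complexes. Let $\beta_1,\dots,\beta_n:K'\to K$ be simplicial maps each having a right strong homotopy inverse, and let $\alpha_1,\dots,\alpha_n:L\to L'$ be simplicial maps each having a left strong homotopy inverse. Assume in addition that $\beta_i\sim\beta_j$ and $\alpha_i\sim\alpha_j$ for all $i,j$. If simplicial maps $\varphi_1,\dots,\varphi_n:K\to L$ and $\psi_1,\dots,\psi_n:K'\to L'$ satisfy $\alpha_j\circ\varphi_j\circ\beta_j\sim\psi_j$ for each $j=1,\dots,n$, then $$\mathrm{SD}_m(\varphi_1,\dots,\varphi_n)=\mathrm{SD}_m(\psi_1,\dots,\psi_n).$$
   Context: Simplicial complexes are abstract simplicial complexes; the complexes $K,K',L,L'$ are assumed edge-path connected (any two vertices are joined by a finite chain of edges). Subcomplexes used in coverings and the test complexes $P$ below need not be connected. Two simplicial maps $\varphi,\psi:A\to B$ are contiguous, $\varphi\sim_c\psi$, if for every simplex $\{v_0,\dots,v_k\}$ of $A$ the set $\{\varphi(v_0),\dots,\varphi(v_k),\psi(v_0),\dots,\psi(v_k)\}$ is a simplex of $B$. They are in the same contiguity class, $\varphi\sim\psi$, if there is a finite sequence of simplicial maps $A\to B$ starting at $\varphi$ and ending at $\psi$ in which consecutive maps are contiguous. A right strong homotopy inverse of $\beta:K'\to K$ is a simplicial map $\gamma:K\to K'$ with $\beta\circ\gamma\sim\mathrm{id}_K$. A left strong homotopy inverse of $\alpha:L\to L'$ is a simplicial map $\gamma:L'\to L$ with $\gamma\circ\alpha\sim\mathrm{id}_L$.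 For simplicial maps $\varphi_1,\dots,\varphi_n:A\to B$, the sequential $m$-contiguity distance $\mathrm{SD}_m(\varphi_1,\dots,\varphi_n)$ is the least integer $k\ge 0$ such that there is a covering of $A$ by subcomplexes $A_0,\dots,A_k$ with the property that, for each $j$ and for every simplicial map $\eta:P\to A_j$ from an $m$-dimensional simplicial complex $P$, the maps $\varphi_1\circ\eta,\dots,\varphi_n\circ\eta:P\to B$ are all in the same contiguity class; it is $\infty$ if there is no such covering. *)

(* Defs.v *)
From mathcomp Require Import all_boot.
From mathcomp Require Import boolp classical_sets functions cardinality.
From mathcomp Require Import constructive_ereal.

Set Implicit Arguments.
Unset Strict Implicit.
Unset Printing Implicit Defensive.

Local Open Scope classical_set_scope.
Local Open Scope card_scope.

(* Complexes may be infinite, infinite-dimensional, disconnected or empty.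
   Simplices are nonempty, and every element of the carrier is a vertex. *)
Record simplicial_complex := SimplicialComplex {
  vertex :> Type;
  simplex : set (set vertex);
  simplex_finite : forall s, simplex s -> finite_set s;
  simplex_nonempty : forall s, simplex s -> s !=set0;
  simplex_face : forall s t, simplex s -> t `<=` s -> t !=set0 -> simplex t;
  simplex_vertex : forall v, simplex [set v] }.

Definition is_edge (K : simplicial_complex) (v w : K) : Prop :=
  v <> w /\ simplex [set v; w].

Definition edge_path_connected (K : simplicial_complex) : Prop :=
  forall v w : K, exists (N : nat) (c : nat -> K),
    [/\ c 0 = v, c N = w & forall i, i < N -> is_edge (c i) (c i.+1)].

Definition of_dimension (m : nat) (K : simplicial_complex) : Prop :=
  (exists s : set K, simplex s /\ s #= `I_m.+1) /\
  (forall s : set K, simplex s -> s #<= `I_m.+1).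

Record simplicial_map (A B : simplicial_complex) := SimplicialMap {
  vertex_map :> A -> B;
  map_simplex : forall s, simplex s -> simplex (vertex_map @` s) }.

Lemma sid_simplex (A : simplicial_complex) (s : set A) :
  simplex s -> simplex (id @` s).
Proof. by rewrite image_id. Qed.

Definition sid (A : simplicial_complex) : simplicial_map A A :=
  SimplicialMap (@sid_simplex A).

Lemma scomp_simplex (A B C : simplicial_complex)
    (g : simplicial_map B C) (f : simplicial_map A B) (s : set A) :
  simplex s -> simplex ((g \o f) @` s).
Proof. by move=> sA; rewrite -image_comp; do 2!apply: map_simplex. Qed.

Definition scomp (A B C : simplicial_complex)
    (g : simplicial_map B C) (f : simplicial_map A B) : simplicial_map A C :=
  SimplicialMap (scomp_simplex g f).

Definition contiguous (A B : simplicial_complex) (f g : simplicial_map A B) :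
    Prop :=
  forall s : set A, simplex s -> simplex (f @` s `|` g @` s).

Definition same_contiguity_class (A B : simplicial_complex)
    (f g : simplicial_map A B) : Prop :=
  exists (N : nat) (c : nat -> simplicial_map A B),
    [/\ c 0 = f, c N = g & forall i, i < N -> contiguous (c i) (c i.+1)].

Definition has_right_strong_inverse (A B : simplicial_complex)
    (f : simplicial_map A B) : Prop :=
  exists g : simplicial_map B A, same_contiguity_class (scomp f g) (sid B).

Definition has_left_strong_inverse (A B : simplicial_complex)
    (f : simplicial_map A B) : Prop :=
  exists g : simplicial_map B A, same_contiguity_class (scomp g f) (sid A).

Record subcomplex (K : simplicial_complex) := Subcomplex {
  subsimplex : set (set K);
  subsimplex_simplex : forall s, subsimplex s -> simplex s;
  subsimplex_face : forall s t,
    subsimplex s -> t `<=` s -> t !=set0 -> subsimplex t }.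

Section ComplexOf.
Variables (K : simplicial_complex) (A : subcomplex K).

(* The vertex set of a subcomplex may be a proper subset of that of K. *)
Definition sub_vertex : Type := set_type [set v : K | subsimplex A [set v]].

Definition sub_val (v : sub_vertex) : K := set_val v.

Definition sub_simplex : set (set sub_vertex) :=
  [set s | subsimplex A (sub_val @` s)].

Lemma sub_val_inj : injective sub_val.
Proof. exact: val_inj. Qed.

Lemma sub_simplex_finite s : sub_simplex s -> finite_set s.
Proof.
move=> /subsimplex_simplex/simplex_finite fs.
have -> : s = sub_val @^-1` (sub_val @` s).
  apply/seteqP; split=> [v sv|v [w sw /sub_val_inj <-]//].
  by exists v.
by apply: finite_preimage fs => v w _ _; exact: sub_val_inj.
Qed.

Lemma sub_simplex_nonempty s : sub_simplex s -> s !=set0.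
Proof. by move=> /subsimplex_simplex/simplex_nonempty[_ [v sv _]]; exists v. Qed.

Lemma sub_simplex_face s t :
  sub_simplex s -> t `<=` s -> t !=set0 -> sub_simplex t.
Proof.
move=> sA ts [v tv]; apply: subsimplex_face sA _ _; first exact: image_subset.
by exists (sub_val v), v.
Qed.

Lemma sub_simplex_vertex v : sub_simplex [set v].
Proof. by rewrite /sub_simplex /= image_set1; exact: (set_valP v). Qed.

Definition complex_of : simplicial_complex :=
  SimplicialComplex sub_simplex_finite sub_simplex_nonempty sub_simplex_face
    sub_simplex_vertex.

Lemma sincl_simplex (s : set complex_of) : simplex s -> simplex (sub_val @` s).
Proof. exact: subsimplex_simplex. Qed.

Definition sincl : simplicial_map complex_of K :=
  @SimplicialMap complex_of K sub_val sincl_simplex.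

End ComplexOf.

Definition is_covering (K : simplicial_complex) (k : nat)
    (A : 'I_k.+1 -> subcomplex K) : Prop :=
  forall s : set K, simplex s -> exists j, subsimplex (A j) s.

Definition SD_covering (m n : nat) (A B : simplicial_complex)
    (phi : 'I_n -> simplicial_map A B) (k : nat) : Prop :=
  exists U : 'I_k.+1 -> subcomplex A, is_covering U /\
    forall (j : 'I_k.+1) (P : simplicial_complex), of_dimension m P ->
    forall (eta : simplicial_map P (complex_of (U j))) (i1 i2 : 'I_n),
      same_contiguity_class
        (scomp (phi i1) (scomp (sincl (U j)) eta))
        (scomp (phi i2) (scomp (sincl (U j)) eta)).

Definition SD (m n : nat) (A B : simplicial_complex)
    (phi : 'I_n -> simplicial_map A B) : \bar nat :=
  xget (+oo)%E [set (k%:E)%E | k in [set k | SD_covering m phi k /\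
    forall l, SD_covering m phi l -> k <= l]].

(* Main.v *)
Require Import Defs.
From mathcomp Require Import all_boot.
From mathcomp Require Import boolp classical_sets.

(** Up to contiguity class the families [phi] and [psi] are obtained from one
    another by composing on both sides with maps independent of the index:
    psi_j ~ alpha_0 phi_j beta_0, and, for a right inverse gamma of beta_0 and
    a left inverse delta of alpha_0, phi_j ~ delta psi_j gamma.  If
    psi_j ~ a phi_j b, then pulling back along [b] turns a covering for [phi]
    into a covering for [psi] of the same size. *)

Set Implicit Arguments.
Unset Strict Implicit.
Unset Printing Implicit Defensive.

Local Open Scope classical_set_scope.

Section ContiguityClass.
Variables A B : simplicial_complex.
Implicit Types f g h : simplicial_map A B.

Lemma contiguous_sym f g : contiguous f g -> contiguous g f.
Proof. by move=> fg s /fg; rewrite setUC. Qed.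

Lemma contiguous_class f g : contiguous f g -> same_contiguity_class f g.
Proof.
by move=> fg; exists 1, (fun i => if i is 0 then f else g); split=> // -[].
Qed.

(** Contiguity only sees images of simplices. This lets reassociated composites be exchanged without
    comparing their proof fields. *)
Lemma class_ext f g : f =1 g -> same_contiguity_class f g.
Proof.
move=> fg; apply: contiguous_class => s sA.
by rewrite -(eq_imagel (fun x _ => fg x)) setUid; exact: map_simplex.
Qed.

Lemma class_refl f : same_contiguity_class f f.
Proof. exact: class_ext. Qed.

Lemma class_sym f g : same_contiguity_class f g -> same_contiguity_class g f.
Proof.
move=> [N [c [c0 cN cS]]]; exists N, (fun i => c (N - i)).
split=> [||i iN]; rewrite ?subn0 ?subnn //.
have := cS (N - i.+1); rewrite -subSn // subSS leq_subr => /(_ isT).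
exact: contiguous_sym.
Qed.

Lemma class_trans g f h : same_contiguity_class f g ->
  same_contiguity_class g h -> same_contiguity_class f h.
Proof.
move=> [N [c [c0 cN cS]]] [M [d [d0 dM dS]]].
exists (N + M), (fun i => if i < N then c i else d (i - N)); split.
(* If [N] is 0, the chain starts in the second branch, at [d 0 = g = c 0 = f]. *)
- by case: N cN {cS} => [|N] cN //=; rewrite d0 -cN.
- by rewrite ltnNge leq_addr /= addKn.
- move=> i iNM; case: (ltnP i.+1 N) => [iN|Ni].
    by rewrite (ltnW iN); apply: cS; exact: ltnW.
  case: (ltnP i N) => [iN|{}Ni].
    (* At the junction the next map is [d 0], which is [c N] since both are [g]. *)
    have iN1 : i.+1 = N by apply/eqP; rewrite eqn_leq iN Ni.
    by rewrite -iN1 subnn d0 -cN -iN1; apply: cS; rewrite -iN1.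
  by rewrite subSn //; apply: dS; rewrite ltn_subLR.
Qed.

End ContiguityClass.

(** One factor moves at a time: [g] carries the simplex [d i (s) U d (i+1) (s)] to a simplex, and
    then the contiguities from [g] to [g'] are applied to the simplex [f' (s)]. *)
Lemma scomp_class (A B C : simplicial_complex) (f f' : simplicial_map A B)
    (g g' : simplicial_map B C) :
  same_contiguity_class g g' -> same_contiguity_class f f' ->
  same_contiguity_class (scomp g f) (scomp g' f').
Proof.
move=> [N [c [c0 cN cS]]] [M [d [d0 dM dS]]].
apply: (@class_trans _ _ (scomp g f')).
- exists M, (fun i => scomp g (d i)); rewrite d0 dM; split=> // i /dS dd s sA.
  have := map_simplex g (dd _ sA); rewrite image_setU !image_comp; exact.
- exists N, (fun i => scomp (c i) f'); rewrite c0 cN; split=> // i /cS cc s sA.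
  have := cc _ (map_simplex f' sA); rewrite !image_comp; exact.
Qed.

Section Preimage.
Variables (A B : simplicial_complex) (b : simplicial_map A B).
Variable U : subcomplex B.

Lemma presub_simplex (s : set A) :
  (simplex s /\ subsimplex U (b @` s)) -> simplex s.
Proof. by case. Qed.

Lemma presub_face (s t : set A) :
  simplex s /\ subsimplex U (b @` s) -> t `<=` s -> t !=set0 ->
  simplex t /\ subsimplex U (b @` t).
Proof.
move=> [sA sU] ts t0; split; first exact: simplex_face sA ts t0.
apply: subsimplex_face sU _ _; first exact: image_subset.
exact: image_nonempty.
Qed.

(** The condition [simplex s] is imposed because [b] may collapse a set that is not a simplex onto a
    simplex of [U]. *)
Definition presub : subcomplex A := @Subcomplex A
  [set s | simplex s /\ subsimplex U (b @` s)] presub_simplex presub_face.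

Lemma presub_vertexP (v : complex_of presub) :
  b (sub_val v) \in [set w | subsimplex U [set w]].
Proof. by apply: mem_set; case: (set_valP v) => _; rewrite image_set1. Qed.

Definition presub_vertex (v : complex_of presub) : complex_of U :=
  exist _ (b (sub_val v)) (presub_vertexP v).

Lemma presub_vertex_simplex (s : set (complex_of presub)) :
  simplex s -> simplex (presub_vertex @` s).
Proof. by case=> _; rewrite /= /sub_simplex /= !image_comp. Qed.

(** The restriction of [b], which turns a test map into the preimage into a test map into [U] with
    the same source [P]. *)
Definition presub_map : simplicial_map (complex_of presub) (complex_of U) :=
  SimplicialMap presub_vertex_simplex.

End Preimage.

Lemma SD_covering_transfer (m n k : nat) (A B A' B' : simplicial_complex)
    (a : simplicial_map B B') (b : simplicial_map A' A)
    (phi : 'I_n -> simplicial_map A B) (psi : 'I_n -> simplicial_map A' B') :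
  (forall i, same_contiguity_class (scomp a (scomp (phi i) b)) (psi i)) ->
  SD_covering m phi k -> SD_covering m psi k.
Proof.
move=> apb [U [Ucov UP]]; exists (fun j => presub b (U j)); split.
  by move=> s sA; have [j Uj] := Ucov _ (map_simplex b sA); exists j.
move=> j P dimP eta i1 i2.
(* On vertices, [b] after the inclusion of the preimage is the inclusion of [U j] after
   [presub_map]; hence [apb i] restricts to this relation. *)
have psiE i : same_contiguity_class
    (scomp a (scomp (phi i)
      (scomp (sincl (U j)) (scomp (presub_map b (U j)) eta))))
    (scomp (psi i) (scomp (sincl (presub b (U j))) eta)).
  apply: class_trans (scomp_class (apb i) (class_refl _)).
  exact: class_ext.
apply: class_trans (psiE i2); apply: class_trans (class_sym (psiE i1)) _.
apply: scomp_class; first exact: class_refl.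
exact: UP.
Qed.

(** [SD] depends on the family only through the predicate [SD_covering], so the value [+oo] needs no
    separate case. *)
Lemma eq_SD (m n : nat) (A B A' B' : simplicial_complex)
    (phi : 'I_n -> simplicial_map A B) (psi : 'I_n -> simplicial_map A' B') :
  (forall k, SD_covering m phi k <-> SD_covering m psi k) ->
  SD m phi = SD m psi.
Proof.
move=> phipsi; have E : SD_covering m phi = SD_covering m psi.
  by apply/funext => k; apply/propext.
by rewrite /SD E.
Qed.

Theorem theorem3p1 (m n : nat) (hn : 1 <= n)
  (K K' L L' : simplicial_complex)
  (hK : edge_path_connected K) (hK' : edge_path_connected K')
  (hL : edge_path_connected L) (hL' : edge_path_connected L')
  (beta : 'I_n -> simplicial_map K' K)
  (hbeta : forall j, has_right_strong_inverse (beta j))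
  (alpha : 'I_n -> simplicial_map L L')
  (halpha : forall j, has_left_strong_inverse (alpha j))
  (hbeta_class : forall i j, same_contiguity_class (beta i) (beta j))
  (halpha_class : forall i j, same_contiguity_class (alpha i) (alpha j))
  (phi : 'I_n -> simplicial_map K L) (psi : 'I_n -> simplicial_map K' L')
  (hpsi : forall j,
    same_contiguity_class (scomp (alpha j) (scomp (phi j) (beta j))) (psi j)) :
  SD m phi = SD m psi.
Proof.
pose j0 := Ordinal hn.
(* The outer maps are frozen at the index [j0], because a transfer needs the same [a] and [b] for
   every [i]. *)
have psiE i :
    same_contiguity_class (scomp (alpha j0) (scomp (phi i) (beta j0))) (psi i).
  apply: class_trans (hpsi i); apply: scomp_class (halpha_class _ _) _.
  exact: scomp_class (class_refl _) (hbeta_class _ _).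
have [gamma bg] := hbeta j0; have [delta da] := halpha j0.
apply: eq_SD => k; split; first exact: SD_covering_transfer psiE.
apply: (@SD_covering_transfer _ _ _ _ _ _ _ delta gamma) => i.
(* After [psi i] is replaced by its composite, regrouping brings [delta] next to [alpha j0] and
   [beta j0] next to [gamma], where [da] and [bg] cancel them. *)
apply: class_trans (_ : same_contiguity_class
  (scomp (scomp delta (alpha j0)) (scomp (phi i) (scomp (beta j0) gamma))) _).
  apply: class_trans (scomp_class (class_refl delta)
    (scomp_class (class_sym (psiE i)) (class_refl gamma))) _.
  exact: class_ext.
apply: class_trans (scomp_class da (scomp_class (class_refl _) bg)) _.
exact: class_ext.
Qed.
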